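(* Let $P$ be a nonzero homogeneous polynomial of degree $N$ on $\mathbb{R}^n$, of the form $$P(x)=\sum_{t,k\in\mathbb{N}_0,\ 2t+k=N}\ \sum_{m=1}^{a_k}a_{t,k,m}|x|^{2t}Y_{k,m}(x)$$ with complex coefficients $a_{t,k,m}$. Let $k_0\in\mathbb{N}_0$ be the largest number such that $a_{t_0,k_0,m_0}\ne0$ for some $t_0\in\mathbb{N}_0$ with $2t_0+k_0=N$ and some $m_0\in\{1,\dots,a_{k_0}\}$. Then $$N_P:=\sup_{k\in\mathbb{N}_0,\ m=1,\dots,a_k}d\big(P(x)Y_{k,m}(x)\big)=\tfrac12(N+k_0).$$
   Context: For each $k\in\mathbb{N}_0$, $Y_{k,m}$, $m=1,\dots,a_k$, is a basis of the space of all homogeneous harmonic polynomials of degree $k$ on $\mathbb{R}^n$ (complex coefficients), orthonormal for $\langle f,g\rangle=\int_{\mathbb{S}^{n-1}}f(\theta)\overline{g(\theta)}\,d\theta$, where $d\theta$ is surface measure on the unit sphere. The polynomials $|x|^{2t}Y_{k,m}(x)$ form a basis of the space of all polynomials. $\Delta=\sum_i\partial^2/\partial x_i^2$, and the polyharmonic degree of a polynomial $f$ is $d(f):=\min\{N\in\mathbb{N}_0:\Delta^{N+1}f=0\}$. *)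

(* Defs.v *)
From HB Require Import structures.
From mathcomp Require Import all_boot all_order all_algebra.
From mathcomp Require Import complex.
(* The notations of mpoly clash with those of MathComp-Analysis: the type of
   polynomials is written [mpoly n K], "homogeneous of degree d" is
   [ishomog1 d mdeg], the i-th variable ['X_i] is [mpolyX _ (mnm1 i)]. *)
From mathcomp.multinomials Require Import -(notations) mpoly.
From mathcomp Require Import all_classical all_reals all_analysis.
From mathcomp Require Import measurable_realfun.

Set Implicit Arguments.
Unset Strict Implicit.
Unset Printing Implicit Defensive.
Import Order.TTheory GRing.Theory Num.Theory.
Import numFieldNormedType.Exports.

Local Open Scope classical_set_scope.
Local Open Scope ring_scope.

(* R^n as n-tuples, for the product of the Borel sigma-algebras. *)
Notation Rn R n := (n.-tuple (measurableTypeR R)).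

Section Lebesgue.
Variable R : realType.

Definition cons_pair n (p : measurableTypeR R * Rn R n) : Rn R n.+1 :=
  [the n.+1.-tuple (measurableTypeR R) of p.1 :: p.2].

Lemma measurable_cons_pair n : measurable_fun setT (@cons_pair n).
Proof. exact: measurable_cons. Qed.

HB.instance Definition _ n :=
  isMeasurableFun.Build _ _ _ _ (@cons_pair n) (@measurable_cons_pair n).

Section LebesgueS.
Variables (mu : {sigma_finite_measure set (measurableTypeR R) -> \bar R}).
Variables (n : nat) (nu : {sigma_finite_measure set (Rn R n) -> \bar R}).

(* The product measure on R^(n+1) = R * R^n, carried over to tuples. *)
Definition lebesgue_cons : set (Rn R n.+1) -> \bar R :=
  pushforward (mu \x nu)%E (@cons_pair n).

Let lebesgue_cons0 : lebesgue_cons set0 = 0%E.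
Proof. exact: measure0. Qed.

Let lebesgue_cons_ge0 A : (0 <= lebesgue_cons A)%E.
Proof. exact: measure_ge0. Qed.

Let lebesgue_cons_sigma_additive : semi_sigma_additive lebesgue_cons.
Proof. exact: measure_semi_sigma_additive. Qed.

HB.instance Definition _ := isMeasure.Build _ _ _ lebesgue_cons
  lebesgue_cons0 lebesgue_cons_ge0 lebesgue_cons_sigma_additive.

Let lebesgue_cons_sigma_finite : sigma_finite setT lebesgue_cons.
Proof.
have /sigma_finiteP[F [TF ndF Foo]] := sigma_finiteT mu.
have /sigma_finiteP[G [TG ndG Goo]] := sigma_finiteT nu.
pose g (x : Rn R n.+1) : measurableTypeR R * Rn R n :=
  (thead x, [tuple of behead x]).
have mg : measurable_fun setT g.
  apply/measurable_fun_pair; first exact: measurable_tnth.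
  exact: measurable_behead.
exists (fun i => g @^-1` (F i `*` G i)) => [|i].
  apply/seteqP; split => // x _.
  have : setT (g x).1 by []. rewrite TF => -[i _ Fi].
  have : setT (g x).2 by []. rewrite TG => -[j _ Gj].
  exists (maxn i j) => //; split.
    by move: (g x).1 Fi; exact/subsetPset/ndF/leq_maxl.
  by move: (g x).2 Gj; exact/subsetPset/ndG/leq_maxr.
have [mF Fioo] := Foo i; have [mG Gioo] := Goo i.
split; first by rewrite -[X in measurable X]setTI; apply: mg => //; exact: measurableX.
have gK : cancel (@cons_pair n) g.
  by case=> x t; congr pair; exact/val_inj.
rewrite /lebesgue_cons /pushforward -comp_preimage.
rewrite (_ : g \o _ = id); last exact/funext.
by rewrite preimage_id product_measure1E// lte_mul_pinfty// ge0_fin_numE.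
Qed.

HB.instance Definition _ :=
  Measure_isSigmaFinite.Build _ _ _ lebesgue_cons lebesgue_cons_sigma_finite.
End LebesgueS.

Fixpoint lebesgue_Rn n : {sigma_finite_measure set (Rn R n) -> \bar R} :=
  if n is n'.+1 then lebesgue_cons lebesgue_measure (lebesgue_Rn n')
  else \d_([tuple] : Rn R 0).

Section Sphere.
Variable n : nat.

Definition enorm (x : Rn R n) : R := Num.sqrt (\sum_(i < n) tnth x i ^+ 2).

Lemma enorm_ge0 x : 0 <= enorm x.
Proof. exact: sqrtr_ge0. Qed.

Definition sphere : set (Rn R n) := [set x | enorm x = 1].

Definition punctured_ball : set (Rn R n) := [set x | 0 < enorm x <= 1].

Definition radial_proj (x : Rn R n) : Rn R n :=
  [tuple tnth x i / enorm x | i < n].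

Lemma measurable_enorm : measurable_fun setT (enorm : Rn R n -> measurableTypeR R).
Proof.
apply: (@measurableT_comp _ _ _ _ _ _ (@Num.sqrt R)).
  by apply: continuous_measurable_fun; exact: sqrt_continuous.
apply: measurable_sum => i; apply: measurable_funX.
exact: measurable_tnth.
Qed.

Lemma measurable_punctured_ball : measurable punctured_ball.
Proof.
have := measurable_enorm measurableT (measurable_itv `]0, 1]).
by rewrite setTI; congr measurable; apply/seteqP; split => x /=; rewrite in_itv.
Qed.

Lemma measurable_radial_proj : measurable_fun setT radial_proj.
Proof.
apply/measurable_fun_tnthP => i.
rewrite (_ : _ \o _ = fun x => tnth x i * (enorm x `^ (-1))); last first.
  by apply/funext => x /=; rewrite tnth_mktuple powR_inv1// enorm_ge0.
apply: measurable_funM; first exact: measurable_tnth.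
apply: (@measurableT_comp _ _ _ _ _ _ (@powR R ^~ (-1))).
  exact: measurable_powR.
exact: measurable_enorm.
Qed.

HB.instance Definition _ :=
  isMeasurableFun.Build _ _ _ _ radial_proj measurable_radial_proj.

(* The surface measure is given by its polar-coordinates characterization:
   sigma(A) = n * lambda {r *: theta | 0 < r <= 1, theta \in A}
   for A a Borel subset of the sphere (the counting measure on {-1, 1} when
   n = 1); as a measure on R^n it is concentrated on the sphere. *)
Definition cone_measure : set (Rn R n) -> \bar R :=
  pushforward (mrestr (lebesgue_Rn n) measurable_punctured_ball) radial_proj.

Let cone_measure0 : cone_measure set0 = 0%E.
Proof. exact: measure0. Qed.

Let cone_measure_ge0 A : (0 <= cone_measure A)%E.
Proof. exact: measure_ge0. Qed.

Let cone_measure_sigma_additive : semi_sigma_additive cone_measure.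
Proof. exact: measure_semi_sigma_additive. Qed.

HB.instance Definition _ := isMeasure.Build _ _ _ cone_measure
  cone_measure0 cone_measure_ge0 cone_measure_sigma_additive.

Definition surface_measure : {measure set (Rn R n) -> \bar R} :=
  mscale n%:R%:nng cone_measure.
End Sphere.
End Lebesgue.

Section Polynomials.
Variables (R : realType) (n : nat).
Local Notation C := R[i].
Implicit Types f g : mpoly n C.

(* The polynomial |x|^2. *)
Definition normsq : mpoly n C := \sum_(i < n) mpolyX C (mnm1 i) ^+ 2.

Definition laplacian f : mpoly n C := \sum_(i < n) mderiv i (mderiv i f).

Definition harmonic_homog k : set (mpoly n C) :=
  [set f | f \is ishomog1 k mdeg /\ laplacian f = 0].

Lemma ex_polyharmonic f : exists N, iter N.+1 laplacian f == 0.
Proof.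
have H j : forall m, (msize f <= mdeg m + j)%N -> mcoeff m (iter j laplacian f) = 0.
  elim: j => [|j IH] m; first by rewrite addn0 => /msize_mdeg_ge/memN_msupp_eq0.
  move=> hm; rewrite /= /laplacian raddf_sum big1// => i _ /=.
  rewrite !mcoeff_deriv IH ?mul0rn// !mdegD !mdeg1.
  by apply: leq_trans hm _; rewrite addnS -addSn leq_add2r !addn1 leqW.
exists (msize f); apply/eqP/mpolyP => m; rewrite mcoeff0 H//.
by rewrite addnS leqW// leq_addl.
Qed.

(* The least N such that the (N+1)-st iterate of the Laplacian kills f; in
   particular the zero polynomial gets degree 0. *)
Definition polyharmonic_degree f : nat := ex_minn (ex_polyharmonic f).

Definition eval_real f (x : Rn R n) : C :=
  meval (fun i => (tnth x i)%:C%C) f.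

Definition sphere_integral (h : Rn R n -> C) : C :=
  Complex (\int[surface_measure R n]_(x in @sphere R n) complex.Re (h x))
          (\int[surface_measure R n]_(x in @sphere R n) complex.Im (h x)).

Definition sphere_inner f g : C :=
  sphere_integral (fun x => eval_real f x * (eval_real g x)^*).

End Polynomials.

(* For subspaces S of a module V that need not be finite dimensional, which
   the bases of vector.v do not cover. *)
Definition is_basis (K : nzRingType) (V : lmodType K) (S : set V) (d : nat)
    (b : 'I_d -> V) : Prop :=
  [/\ forall i, S (b i),
      forall c : 'I_d -> K, \sum_(i < d) c i *: b i = 0 -> forall i, c i = 0
    & forall v, S v -> exists c : 'I_d -> K, v = \sum_(i < d) c i *: b i].


Definition spherical_harmonics_basis (R : realType) (n : nat) (a : nat -> nat)
    (Y : forall k, 'I_(a k) -> mpoly n R[i]) : Prop :=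
  forall k, is_basis (@harmonic_homog R n k) (Y k) /\
    forall m l, sphere_inner (Y k m) (Y k l) = (m == l)%:R.

(* The supremum is taken in the extended reals, so that a priori it may be
   infinite. *)
Definition sup_degree (R : realType) (n : nat) (a : nat -> nat)
    (Y : forall k, 'I_(a k) -> mpoly n R[i]) (P : mpoly n R[i]) : \bar R :=
  ereal_sup [set e | exists k (m : 'I_(a k)),
    e = (polyharmonic_degree (P * Y k m))%:R%:E].

(* Main.v *)
Require Import Defs.
From HB Require Import structures.
From mathcomp Require Import all_boot all_order all_algebra.
From mathcomp Require Import complex.
From mathcomp.multinomials Require Import -(notations) mpoly.
From mathcomp Require Import all_classical all_reals all_analysis.
From mathcomp Require Import zify ring.

Set Implicit Arguments.
Unset Strict Implicit.
Unset Printing Implicit Defensive.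
Import Order.TTheory GRing.Theory Num.Theory.
Local Open Scope ring_scope.

(** The supremum is computed by differentiating products, without integrating
    over the sphere.

    If [f] and [g] are harmonic then [Delta (f g) = 2 sum_i d_i f * d_i g], and
    the derivatives are harmonic again.  Iterating, [Delta^j (f g)] is [2^j]
    times a sum of products of [j]-th derivatives, so it vanishes once [j]
    exceeds the degree of [f] ([iter_laplacian_harmonicM]).  A factor [|x|^2]
    raises the polyharmonic degree by at most one
    ([iter_laplacian_normsqXM_eq0]), hence [|x|^(2t) Y_(k,m) g] has
    polyharmonic degree at most [t + k = (N + k) / 2] for every harmonic [g].
    This gives the upper bound [(N + k0) / 2].

    For the lower bound let [H] be the combination of the [Y_(k0,m)] that
    multiplies [|x|^(2 t0)] in [P], where [2 t0 + k0 = N].  Taking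
    [f = H] and [g] the conjugate of [H], the same iteration turns
    [Delta^k0 (H conj H)] into [2^k0] times the sum of the squared moduli of
    all [k0]-th derivatives of [H], a positive constant as [H <> 0]
    ([iter_laplacian_normM]).  Multiplying by [|x|^(2 t0)] keeps
    [Delta^(t0 + k0)] a nonzero constant ([iter_laplacian_normsqXM_const]),
    while all the other terms of [P] have a smaller index [k] and are killed
    by [Delta^(t0 + k0)] after multiplication by [conj H].  So
    [Delta^(t0 + k0) (P conj H) <> 0], and since [conj H] is a combination of
    the [Y_(k0,m)], one of these already attains the bound. *)

(** * Linearity and the product rule for the Laplacian *)

Section LaplacianAlgebra.
Variables (R : realType) (n : nat).
Local Notation C := R[i].
Local Notation poly := (mpoly n C).
Local Notation lap := (@laplacian R n).
Local Notation var i := (mpolyX C (mnm1 i)).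
Implicit Types (f g F : poly) (i : 'I_n).

(** [euler] acts on homogeneous polynomials of degree [d] as multiplication by
    [d]; keeping it as an operator makes the commutation rules below valid
    without any homogeneity assumption. *)
Definition euler F : poly := \sum_(i < n) var i * mderiv i F.

Lemma laplacian_is_linear : linear lap.
Proof.
move=> c f g; rewrite /laplacian scaler_sumr -big_split /=.
by apply: eq_bigr => i _; rewrite !linearP.
Qed.

HB.instance Definition _ := GRing.isLinear.Build C poly poly _
  lap laplacian_is_linear.

Lemma iter_laplacian_is_linear k : linear (iter k lap).
Proof. by elim: k => [//|k IH] c f g; rewrite !iterS IH linearP. Qed.

HB.instance Definition _ k := GRing.isLinear.Build C poly poly _
  (iter k lap) (iter_laplacian_is_linear k).

Lemma mderiv_var i j : mderiv i (var j) = (i == j)%:R.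
Proof.
rewrite mderivX mnm1E eq_sym; case: eqVneq => [->|_].
  rewrite (_ : mnm_sub _ _ = mnm0) ?mpolyX0 ?scale1r//.
  by apply/mnmP => l; rewrite mnmBE subnn mnm0E.
by rewrite scale0r.
Qed.

Lemma mderiv_normsq i : mderiv i (normsq R n) = var i *+ 2.
Proof.
rewrite /normsq raddf_sum (bigD1 i)//= big1 ?addr0 => [|j ji].
  by rewrite expr2 mderivM mderiv_var eqxx mul1r mulr1 mulr2n.
by rewrite expr2 mderivM mderiv_var eq_sym (negbTE ji) mul0r mulr0 addr0.
Qed.

Lemma laplacianM f g :
  lap (f * g) = lap f * g + f * lap g
                + (\sum_(i < n) mderiv i f * mderiv i g) *+ 2.
Proof.
rewrite /laplacian mulr_suml mulr_sumr -sumrMnl -!big_split /=.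
apply: eq_bigr => i _; rewrite mderivM mderivD !mderivM; ring.
Qed.

Lemma laplacian_normsq : lap (normsq R n) = (n.*2)%:R.
Proof.
rewrite /laplacian (eq_bigr (fun=> 2%:R)) => [|i _].
  by rewrite sumr_const card_ord -mulrnA mul2n.
by rewrite mderiv_normsq mderivMn mderiv_var eqxx.
Qed.

Lemma laplacian_normsqM F :
  lap (normsq R n * F) = normsq R n * lap F + euler F *+ 4 + F *+ n.*2.
Proof.
have E2 : (\sum_(i < n) mderiv i (normsq R n) * mderiv i F) *+ 2 = euler F *+ 4.
  rewrite /euler -!sumrMnl; apply: eq_bigr => i _.
  by rewrite mderiv_normsq mulrnAl -mulrnA.
rewrite laplacianM laplacian_normsq E2 mulr_natl.
by rewrite [_ + normsq R n * _]addrC addrAC.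
Qed.

(** * Commuting powers of the Laplacian with multiplication by the squared norm *)

Lemma mderiv_laplacian i F : mderiv i (lap F) = lap (mderiv i F).
Proof.
rewrite /laplacian raddf_sum; apply: eq_bigr => j _ /=.
by rewrite mderiv_comm (mderiv_comm j i).
Qed.

Lemma laplacian_var i : lap (var i) = 0.
Proof.
by rewrite /laplacian big1// => j _; rewrite mderiv_var -mpolyC_nat mderivC.
Qed.

Lemma laplacian_euler F : lap (euler F) = euler (lap F) + lap F *+ 2.
Proof.
rewrite {1}/euler raddf_sum /= [X in _ + X *+ 2]/laplacian -sumrMnl -big_split /=.
apply: eq_bigr => i _.
rewrite laplacianM laplacian_var mul0r add0r mderiv_laplacian; congr (_ + _ *+ 2).
rewrite (bigD1 i)//= big1 ?addr0 => [|j ji]; rewrite mderiv_var.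
  by rewrite eqxx mul1r.
by rewrite (negbTE ji) mul0r.
Qed.

(** Each Laplacian that crosses [|x|^2] leaves [4 euler + 2n], and moving this
    [euler] to the left past the remaining Laplacians costs 2 for each of them:
    the coefficients sum the arithmetic progression
    [2n + 8i], [0 <= i <= j], to [(j + 1)(2n + 4j)]. *)
Lemma iter_laplacian_normsqM j F :
  iter j.+1 lap (normsq R n * F) = normsq R n * iter j.+1 lap F
    + euler (iter j lap F) *+ (4 * j.+1)
    + iter j lap F *+ (j.+1 * (n.*2 + 4 * j)).
Proof.
elim: j => [|j IH]; first by rewrite /= laplacian_normsqM !muln1 muln0 addn0 mul1n.
have -> : (4 * j.+2 = 4 + 4 * j.+1)%N by lia.
have -> : (j.+2 * (n.*2 + 4 * j.+1) = n.*2 + 2 * (4 * j.+1) + j.+1 * (n.*2 + 4 * j))%N.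
  by nia.
move: (4 * _)%N (j.+1 * _)%N IH => p q IH.
rewrite iterS IH !raddfD /= !raddfMn /= laplacian_normsqM laplacian_euler.
set E := euler _; set L := lap (iter j lap F).
rewrite !mulrnDl !mulrnDr -!addrA add0r.
by do 5 congr (_ + _); rewrite addrCA.
Qed.

Lemma iter_laplacian0 k : iter k lap 0 = 0.
Proof. exact: raddf0. Qed.

Lemma iter_laplacian_eq0_le k l F : (k <= l)%N -> iter k lap F = 0 ->
  iter l lap F = 0.
Proof. by move=> kl F0; rewrite -(subnK kl) iterD F0 iter_laplacian0. Qed.

Lemma iter_laplacian_normsqXM_eq0 j t F :
  iter j lap F = 0 -> iter (t + j) lap (normsq R n ^+ t * F) = 0.
Proof.
move=> F0; elim: t => [|t IH]; first by rewrite mul1r.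
rewrite addSn exprS -mulrA iter_laplacian_normsqM iterS IH raddf0 mulr0 add0r.
by rewrite mul0rn addr0 /euler big1 ?mul0rn// => i _; rewrite mderiv0 mulr0.
Qed.

(** If [Delta^j F] is constant, then [euler] and the Laplacian kill it, and only
    the last term of [iter_laplacian_normsqM] survives; its coefficient is
    nonzero because [n > 0]. *)
Lemma iter_laplacian_normsqXM_const (n_gt0 : (0 < n)%N) j t F c :
  c != 0 -> iter j lap F = mpolyC n c ->
  exists2 c', c' != 0 & iter (t + j) lap (normsq R n ^+ t * F) = mpolyC n c'.
Proof.
move=> c0 Fc; elim: t => [|t [c' c'0 IH]]; first by exists c; rewrite ?mul1r.
exists (c' *+ ((t + j).+1 * (n.*2 + 4 * (t + j)))).
  by rewrite mulrn_eq0 negb_or c'0 andbT -lt0n muln_gt0 addn_gt0 double_gt0 n_gt0.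
rewrite addSn exprS -mulrA iter_laplacian_normsqM iterS IH.
rewrite (_ : lap _ = 0) ?mulr0 ?add0r; last first.
  by rewrite /laplacian big1// => i _; rewrite mderivC mderiv0.
rewrite /euler big1 ?mul0rn ?add0r ?mpolyCMn// => i _.
by rewrite mderivC mulr0.
Qed.

(** * Products of harmonic polynomials *)

Lemma laplacianM_harmonic f g : lap f = 0 -> lap g = 0 ->
  lap (f * g) = (\sum_(i < n) mderiv i f * mderiv i g) *+ 2.
Proof. by move=> f0 g0; rewrite laplacianM f0 g0 mul0r mulr0 !add0r. Qed.

Lemma harmonic_mderiv i f : lap f = 0 -> lap (mderiv i f) = 0.
Proof. by move=> f0; rewrite -mderiv_laplacian f0 mderiv0. Qed.

Lemma dhomog_mderiv i k f :
  f \is ishomog1 k.+1 mdeg -> mderiv i f \is ishomog1 k mdeg.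
Proof.
move=> /dhomogP hf; apply/dhomogP => m.
rewrite mcoeff_msupp mcoeff_deriv mulrn_eq0 /= -mcoeff_msupp => /hf.
by rewrite /= mdegD mdeg1 addn1 => -[].
Qed.

(** Induction on the degree: one Laplacian replaces [f] and [g] by harmonic
    derivatives, and lowers the degree of [f]. *)
Lemma iter_laplacian_harmonicM k f g : f \is ishomog1 k mdeg ->
  lap f = 0 -> lap g = 0 -> iter k.+1 lap (f * g) = 0.
Proof.
elim: k f g => [|k IH] f g hf f0 g0; rewrite iterSr laplacianM_harmonic//.
  rewrite big1 ?mul0rn// => i _.
  have -> : mderiv i f = 0; last by rewrite mul0r.
  apply/mpolyP => m; rewrite mcoeff_deriv mcoeff0.
  rewrite (dhomog_nemf_coeff hf) ?mul0rn//.
  by rewrite /= mdegD mdeg1 addn1.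
rewrite raddfMn raddf_sum big1 ?mul0rn// => i _; apply: IH.
- exact: dhomog_mderiv.
- exact: harmonic_mderiv.
- exact: harmonic_mderiv.
Qed.

(** Conjugating the coefficients is pointwise conjugation on [R^n]. *)
Definition conjp f : poly := map_mpoly Num.conj f.

Lemma mderiv_conjp i f : mderiv i (conjp f) = conjp (mderiv i f).
Proof.
apply/mpolyP => m; rewrite mcoeff_deriv !mcoeff_map_mpoly mcoeff_deriv /=.
by rewrite rmorphMn.
Qed.

Lemma laplacian_conjp f : lap (conjp f) = conjp (lap f).
Proof.
rewrite /laplacian [in RHS]/conjp raddf_sum; apply: eq_bigr => i _.
by rewrite !mderiv_conjp.
Qed.

Lemma dhomog_conjp k f :
  f \is ishomog1 k mdeg -> conjp f \is ishomog1 k mdeg.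
Proof.
move=> /dhomogP hf; apply/dhomogP => m.
by rewrite mcoeff_msupp mcoeff_map_mpoly conjC_eq0 -mcoeff_msupp => /hf.
Qed.

Lemma dhomog_mderiv_eq0 k f : f \is ishomog1 k.+1 mdeg ->
  (forall i, mderiv i f = 0) -> f = 0.
Proof.
move=> hf f0; apply/mpolyP => m; rewrite mcoeff0.
have [mk|mk] := eqVneq (mdeg m) k.+1; last exact: dhomog_nemf_coeff hf _.
have [i mi] : exists i, m i != 0%N.
  apply/existsP; apply: contra_eqT mk => /existsPn m0.
  by rewrite mdegE big1// => i _; apply/eqP; rewrite -[_ == _]negbK m0.
have := congr1 (mcoeff (mnm_sub m (mnm1 i))) (f0 i).
rewrite mcoeff0 mcoeff_deriv submK ?lep1mP// => /eqP.
by rewrite mulrn_eq0 /= => /eqP.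
Qed.

(** The constant is, up to [2^k], the sum of the squared moduli of the [k]-th
    derivatives of [f], that is, the squared Fischer norm of [f] up to a factor.  The
    equality case is carried through the induction to know that the constant is
    positive when [f] is nonzero. *)
Lemma iter_laplacian_normM k f : f \is ishomog1 k mdeg -> lap f = 0 ->
  exists2 c, 0 <= c ?= iff (f == 0) & iter k lap (f * conjp f) = mpolyC n c.
Proof.
elim: k f => [|k IH] f hf f0.
  have -> : f = mpolyC n (mcoeff mnm0 f).
    apply/mpolyP => m; rewrite mcoeffC.
    have [->|m0] := eqVneq m mnm0; first by rewrite mulr1.
    by rewrite mulr0 (dhomog_nemf_coeff hf)// mdeg_eq0.
  set a := mcoeff _ f; exists (a * a^*).
    split; first exact: mul_conjC_ge0.
    by rewrite eq_sym mul_conjC_eq0 mpolyC_eq0.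
  by rewrite /conjp map_mpolyC mpolyCM.
have /fin_all_exists2[c c0 cE] i := IH _ (dhomog_mderiv i hf) (harmonic_mderiv i f0).
exists ((\sum_i c i) *+ 2); last first.
  rewrite iterSr laplacianM_harmonic ?laplacian_conjp ?f0 ?[conjp 0]raddf0//.
  rewrite raddfMn raddf_sum mpolyCMn raddf_sum; congr (_ *+ _).
  by apply: eq_bigr => i _ /=; rewrite mderiv_conjp cE.
have cge i : 0 <= c i by case: (c0 i).
split; first by rewrite mulrn_wge0// sumr_ge0.
rewrite eq_sym mulrn_eq0 /= psumr_eq0//; apply/allP/eqP => [d0|fz i _].
  apply: (dhomog_mderiv_eq0 hf) => i; apply/eqP.
  by rewrite -(c0 i).2 eq_sym; apply: (d0 i (mem_index_enum i)).
by rewrite /= eq_sym (c0 i).2 fz mderiv0.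
Qed.

(** * Bounds on the polyharmonic degree *)

Lemma polyharmonic_degree_le k f :
  iter k.+1 lap f = 0 -> (polyharmonic_degree f <= k)%N.
Proof.
by move=> f0; rewrite /polyharmonic_degree; case: ex_minnP => d _ -> //; apply/eqP.
Qed.

Lemma polyharmonic_degree_ge k f :
  iter k lap f != 0 -> (k <= polyharmonic_degree f)%N.
Proof.
rewrite /polyharmonic_degree; case: ex_minnP => d /eqP d0 _; apply: contraNT.
by rewrite -ltnNge => dk; rewrite (iter_laplacian_eq0_le dk).
Qed.

End LaplacianAlgebra.

Theorem theorem21 (R : realType) (n : nat) (hn : (0 < n)%N)
    (a : nat -> nat) (Y : forall k : nat, 'I_(a k) -> mpoly n R[i])
    (hY : spherical_harmonics_basis Y)
    (N : nat) (P : mpoly n R[i]) (hP0 : P != 0) (hP : P \is ishomog1 N mdeg)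
    (c : nat -> forall k : nat, 'I_(a k) -> R[i])
    (hPc : P = \sum_(t < N.+1) \sum_(k < N.+1 | (2 * t + k == N)%N)
                 \sum_(m < a k) c t k m *: (normsq R n ^+ t * Y k m))
    (k0 : nat)
    (hk0 : exists (t0 : nat) (m0 : 'I_(a k0)),
             (2 * t0 + k0 = N)%N /\ c t0 k0 m0 != 0)
    (hk0max : forall (k t : nat) (m : 'I_(a k)),
                (2 * t + k = N)%N -> c t k m != 0 -> (k <= k0)%N) :
  sup_degree Y P = ((N + k0)%:R / 2)%:E.
Proof.
have YP k m : Y k m \is ishomog1 k mdeg /\ laplacian (Y k m) = 0.
  by have [[/(_ m) []]] := hY k.
have [t0 [m0 [Nt0 cm0]]] := hk0.
have NkE : (N + k0 = (t0 + k0).*2)%N by rewrite -Nt0 -addnn; lia.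
(* Each term of [P] times a harmonic polynomial is polyharmonic of degree at
   most [t + k]; this serves both bounds. *)
have term0 s t k l (g : mpoly n R[i]) : laplacian g = 0 ->
    (c t k l != 0 -> (t + k < s)%N) ->
    iter s (@laplacian R n) (c t k l *: (normsq R n ^+ t * Y k l) * g) = 0.
  move=> g0; have [->|c0 /(_ isT) tks] := eqVneq (c t k l) 0.
    by rewrite scale0r mul0r iter_laplacian0.
  rewrite -scalerAl -mulrA linearZ /= (iter_laplacian_eq0_le tks) ?scaler0//.
  rewrite -addnS iter_laplacian_normsqXM_eq0//.
  by have [? ?] := YP k l; exact: iter_laplacian_harmonicM.
have upper k m : (polyharmonic_degree (P * Y k m)%R <= t0 + k0)%N.
  apply: polyharmonic_degree_le; rewrite hPc mulr_suml raddf_sum big1// => t _.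
  rewrite mulr_suml raddf_sum big1// => k1 /eqP Nk1.
  rewrite mulr_suml raddf_sum big1// => l _.
  apply: term0; [exact: (YP k m).2|move=> ct].
  by have := hk0max _ _ _ Nk1 ct; lia.
pose H := \sum_(m < a k0) c t0 k0 m *: Y k0 m.
have Hh : H \is ishomog1 k0 mdeg.
  by apply: rpred_sum => m _; apply: rpredZ; exact: (YP k0 m).1.
have H0 : laplacian H = 0.
  by rewrite raddf_sum big1// => m _ /=; rewrite linearZ /= (YP k0 m).2 scaler0.
have Hneq0 : H != 0.
  apply: contra_neq cm0 => /[dup] HE; have [[_ free _] _] := hY k0.
  by move/free.
have lower : exists m, (t0 + k0 <= polyharmonic_degree (P * Y k0 m)%R)%N.
  suff [m Pm] : exists m, iter (t0 + k0) (@laplacian R n) (P * Y k0 m) != 0.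
    by exists m; exact: polyharmonic_degree_ge.
  (* If the product with every basis element were killed, so would be, by
     linearity, the product with the conjugate of [H]. *)
  apply: contrapT => /forallNP PY0.
  have [[_ _ span] _] := hY k0.
  have [] := span (conjp H).
    by split; [exact: dhomog_conjp|rewrite laplacian_conjp H0 [conjp 0]raddf0].
  move=> b Hb.
  have PH0 : iter (t0 + k0) (@laplacian R n) (P * conjp H) = 0.
    rewrite Hb mulr_sumr raddf_sum big1// => m _.
    rewrite /= -scalerAr linearZ /=; have /negP := PY0 m; rewrite negbK => /eqP ->.
    exact: scaler0.
  have [d [dge dE] Hd] := iter_laplacian_normM Hh H0.
  have d0 : d != 0 by rewrite eq_sym dE.
  have [e e0 He] := iter_laplacian_normsqXM_const hn t0 d0 Hd.
  suff PHe : iter (t0 + k0) (@laplacian R n) (P * conjp H) = mpolyC n e.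
    by move: PH0; rewrite PHe => /eqP; rewrite mpolyC_eq0 (negbTE e0).
  have cH0 : laplacian (conjp H) = 0 by rewrite laplacian_conjp H0 [conjp 0]raddf0.
  have t0N : (t0 < N.+1)%N by lia.
  have k0N : (k0 < N.+1)%N by lia.
  (* Only the terms with [(t, k) = (t0, k0)] contribute, and they add up to
     [|x|^(2 t0) H]. *)
  rewrite {1}hPc mulr_suml raddf_sum (bigD1 (Ordinal t0N))//= [X in _ + X]big1 => [|t tt0].
    rewrite addr0 mulr_suml raddf_sum (bigD1 (Ordinal k0N))/=; last by rewrite Nt0.
    rewrite [X in _ + X]big1 => [|k /andP[/eqP Nk /eqP kk0]]; last first.
      by case: kk0; apply: val_inj => /=; lia.
    rewrite addr0 -He; congr (iter _ _ _); rewrite mulrA; congr (_ * _).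
    by rewrite mulr_sumr; apply: eq_bigr => m _; rewrite scalerAr.
  rewrite mulr_suml raddf_sum big1// => k /eqP Nk.
  rewrite mulr_suml raddf_sum big1// => l _.
  apply: term0 => // ct; have := hk0max _ _ _ Nk ct.
  (* [t <> t0] forces [k <> k0], hence [k < k0] by maximality. *)
  have /eqP : t != t0 :> nat by apply: contraNneq tt0 => tt0; exact/eqP/val_inj.
  by lia.
have -> : ((N + k0)%:R / 2 = (t0 + k0)%:R :> R)%R.
  by rewrite NkE -muln2 natrM mulfK// pnatr_eq0.
apply/eqP; rewrite eq_le; apply/andP; split.
  by apply: ge_ereal_sup => _ [k [m ->]]; rewrite lee_fin ler_nat.
have [m hm] := lower.
apply: ereal_sup_ubound; exists k0, m; congr (_%:R%:E).
by apply/eqP; rewrite eqn_leq hm upper.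
Qed.
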